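(* Let $p$ be a prime, let $G=C_p\times C_p$, and let $\mathsf{S}$ be a supercharacter theory of $G$ that has a nonidentity superclass of size one or a nonprincipal linear supercharacter (that is, a basic $\mathsf{S}$-character of degree $1$ different from the principal character). Then $\mathsf{S}$ comes from a supercharacter theory product: either $\mathsf{S}=\mathsf{U}\ast\mathsf{V}$ for some nontrivial proper subgroup $N$ of $G$, some supercharacter theory $\mathsf{U}$ of $N$ and some supercharacter theory $\mathsf{V}$ of $G/N$; or $\mathsf{S}=\mathsf{E}\times\mathsf{F}$ for some nontrivial proper subgroups $H,K$ with $G=H\times K$ and some supercharacter theories $\mathsf{E}$ of $H$ and $\mathsf{F}$ of $K$. In particular, $\mathsf{S}$ comes from automorphisms.
   Context: A supercharacter theory of a finite group $G$ is a pair $\mathsf{S}=(\mathcal{X},\mathcal{K})$, where $\mathcal{X}$ is a partition of $\mathrm{Irr}(G)$ and $\mathcal{K}$ is a partition of $G$, such that $|\mathcal{X}|=|\mathcal{K}|$, $\{1\}\in\mathcal{K}$, and for every $X\in\mathcal{X}$ there is a (nonzero) character $\xi_X$ whose irreducible constituents lie in $X$ and which is constant on each part of $\mathcal{K}$. The parts of $\mathcal{K}$ are the $\mathsf{S}$-classes (superclasses), $\mathrm{Cl}(\mathsf{S})=\mathcal{K}$; the characters $\sigma_X=\sum_{\psi\in X}\psi(1)\psi$, $X\in\mathcal{X}$, are the basic $\mathsf{S}$-characters (supercharacters). A supercharacter theory is uniquely determined by its superclasses. $\mathsf{S}$ comes from automorphisms if there is a subgroup $A\le\mathrm{Aut}(G)$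 such that the $\mathsf{S}$-classes are exactly the orbits of $A$ on $G$ (equivalently, $\mathcal{K}$ and $\mathcal{X}$ are the sets of $A$-orbits on $G$ and on $\mathrm{Irr}(G)$). For $G$ abelian, $N\le G$, $\mathsf{U}$ a supercharacter theory of $N$ and $\mathsf{V}$ a supercharacter theory of $G/N$, the $\ast$-product $\mathsf{U}\ast\mathsf{V}$ is the supercharacter theory of $G$ whose superclasses are the $\mathsf{U}$-classes together with the full preimages in $G$ of the nonidentity $\mathsf{V}$-classes under $G\to G/N$. If $G=H\times K$, $\mathsf{E}$ is a supercharacter theory of $H$ and $\mathsf{F}$ is a supercharacter theory of $K$, the direct product $\mathsf{E}\times\mathsf{F}$ is the supercharacter theory of $G$ whose superclasses are the sets $A\times B$ with $A\in\mathrm{Cl}(\mathsf{E})$ and $B\in\mathrm{Cl}(\mathsf{F})$. *)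

(* Defs.v *)
From mathcomp Require Import all_boot all_order all_algebra all_fingroup.
From mathcomp Require Import all_solvable all_field all_character.

Set Implicit Arguments.
Unset Strict Implicit.
Unset Printing Implicit Defensive.

Import GroupScope GRing.Theory.

(* Irr(G) is represented by its index type Iirr G, with i standing for 'chi_i *)
Record superchar_theory (gT : finGroupType) (G : {group gT}) := SupercharTheory {
  char_parts : {set {set Iirr G}};
  superclasses : {set {set gT}};
  char_parts_partition : partition char_parts [set: Iirr G];
  superclasses_partition : partition superclasses G;
  card_char_parts : #|char_parts| = #|superclasses|;
  superclass1 : [set 1] \in superclasses;
  char_parts_constant : forall X : {set Iirr G}, X \in char_parts ->
    exists xi : 'CF(G),
      [/\ xi \is a character, xi != 0%R, {subset irr_constt xi <= X}
        & forall B : {set gT}, B \in superclasses ->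
            {in B &, forall x y, xi x = xi y}]
}.

Definition basic_char (gT : finGroupType) (G : {group gT}) (X : {set Iirr G}) :
    'CF(G) :=
  (\sum_(i in X) 'chi_i 1%g *: 'chi_i)%R.

Definition from_automorphisms (gT : finGroupType) (G : {group gT})
    (S : superchar_theory G) : Prop :=
  exists A : {group {perm gT}},
    A \subset Aut G /\ superclasses S = [set orbit 'P A x | x in G].

(* Superclasses determine a supercharacter theory, so the two products are
   specified through the superclasses of S. *)
Definition is_star_product (gT : finGroupType) (G N : {group gT})
    (S : superchar_theory G) (U : superchar_theory N)
    (V : superchar_theory (G / N)%G) : Prop :=
  superclasses S = superclasses U
    :|: [set G :&: coset N @*^-1 B | B in superclasses V :\ [set 1]].

(* To be used when H \x K = G: the pointwise product A * B in G is then the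
   image of the cartesian product of A and B. *)
Definition is_direct_product (gT : finGroupType) (G H K : {group gT})
    (S : superchar_theory G) (E : superchar_theory H)
    (F : superchar_theory K) : Prop :=
  superclasses S = [set A * B | A in superclasses E, B in superclasses F].

(* Main.v *)
Require Import Defs.
From mathcomp Require Import all_boot all_order all_algebra all_fingroup.
From mathcomp Require Import all_solvable all_field all_character.
From mathcomp Require Import ring.

Set Implicit Arguments.
Unset Strict Implicit.
Unset Printing Implicit Defensive.

Import GroupScope GRing.Theory Num.Theory.
Local Open Scope ring_scope.
Local Open Scope group_scope.

(** Write x ~ y when x and y lie in the same superclass. For G abelian the
    superclasses and the parts of Irr(G) determine each other: x ~ y exactly when
    all basic characters agree at x and y, and a function is constant on
    superclasses exactly when its Fourier coefficients are constant on parts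
    (superclass_funP and same_classP). Every symmetry used below follows by
    applying this to a suitable function. Power maps preserve both partitions,
    because Galois conjugation permutes the functions constant on superclasses.
    If {z} is a superclass, multiplication by z preserves ~, because the value at
    z of an irreducible character depends only on its part. If {lambda} is a part,
    multiplication by lambda preserves the parts, because lambda is itself
    constant on superclasses.

    Now let G = C_p x C_p. In the first case take coordinates
    (s, t) |-> x^s z^t on G, in the second coordinates (i, j) |-> mu^i lambda^j on
    Irr(G). Either way the partition of F_p^2 is invariant under nonzero scalars
    and under translation by (0, t), and its blocks on the axis {0} x F_p are
    points. Scalars and translations together act on F_p^* x F_p as AGL(1, p)
    acts regularly on itself, so the blocks off the axis are the orbits of the maps
    (i, j) |-> (a i, j + r i) with (a, r) in a subgroup B of AGL(1, p)
    (colourP). Either B contains all translations (1, r), or it meets them trivially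
    and is then conjugate into F_p^*, that is, r = k (a - 1) for one fixed k
    (stab_dichotomy).

    In the first case these maps are automorphisms of G preserving the superclasses,
    and the dichotomy says that S is a star product over <z> or a direct product of
    <x z^k> and <z>. In the second case the adjoint maps
    (s, t) |-> (a s + r t, t) act on G, where y^t is detected by lambda and x
    generates its kernel. They preserve superclasses since they preserve parts, and
    an orbit of them is a union of superclasses since the Fourier coefficients of
    its indicator are constant on parts. So the superclasses are the orbits, and the
    dichotomy gives a star product over <x> or a direct product of <x> and
    <x^(-k) y>.

    The factors of these products are partitions of groups of prime order invariant
    under power maps. Any such partition containing {1} is the set of superclasses
    of a supercharacter theory (prime_superchar_theory): a group of prime order and
    its dual are isomorphic compatibly with power maps, so the partition can be
    transported to the irreducible characters. *)

(** * Functions constant on superclasses *)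

Section SuperclassFunctions.

Variables (gT : finGroupType) (G : {group gT}) (S : superchar_theory G).
Hypothesis cGG : abelian G.

Definition same_class x y :=
  pblock (superclasses S) x == pblock (superclasses S) y.

Definition same_part i j :=
  pblock (char_parts S) i == pblock (char_parts S) j.

Definition superclass_fun (f : 'CF(G)) :=
  {in G &, forall x y, same_class x y -> f x = f y}.

Lemma trivIset_superclasses : trivIset (superclasses S).
Proof. by have /and3P[] := superclasses_partition S. Qed.

Lemma cover_superclasses : cover (superclasses S) = G.
Proof. by have /and3P[/eqP] := superclasses_partition S. Qed.

Lemma trivIset_char_parts : trivIset (char_parts S).
Proof. by have /and3P[] := char_parts_partition S. Qed.

Lemma cover_char_parts : cover (char_parts S) = [set: Iirr G].
Proof. by have /and3P[/eqP] := char_parts_partition S. Qed.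

Lemma mem_superclass x : x \in G -> x \in pblock (superclasses S) x.
Proof. by rewrite mem_pblock cover_superclasses. Qed.

Lemma superclass_mem x : x \in G -> pblock (superclasses S) x \in superclasses S.
Proof. by move=> Gx; apply: pblock_mem; rewrite cover_superclasses. Qed.

Lemma same_classE x y :
  x \in G -> same_class x y = (y \in pblock (superclasses S) x).
Proof.
move=> Gx; rewrite /same_class eq_pblock ?cover_superclasses //.
exact: trivIset_superclasses.
Qed.

Lemma superclass_sub B : B \in superclasses S -> B \subset G.
Proof. by move=> SB; rewrite -cover_superclasses; apply: bigcup_sup. Qed.

Lemma superclass_def B x :
  B \in superclasses S -> x \in B -> pblock (superclasses S) x = B.
Proof. exact: def_pblock trivIset_superclasses. Qed.

Lemma superclass_nonempty B : B \in superclasses S -> exists2 x, x \in B & x \in G.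
Proof.
move=> SB; have [B0|[x Bx]] := set_0Vmem B; last first.
  by exists x => //; apply: subsetP Bx; apply: superclass_sub.
by have /and3P[_ _ /negP[]] := superclasses_partition S; rewrite -B0.
Qed.

Lemma same_class_mem x y : x \in G -> same_class x y -> y \in G.
Proof.
move=> Gx; rewrite same_classE //; apply: subsetP.
exact/superclass_sub/superclass_mem.
Qed.

Lemma mem_char_part i : i \in pblock (char_parts S) i.
Proof. by rewrite mem_pblock cover_char_parts. Qed.

Lemma char_part_mem i : pblock (char_parts S) i \in char_parts S.
Proof. by apply: pblock_mem; rewrite cover_char_parts. Qed.

Lemma same_partE i j : same_part i j = (j \in pblock (char_parts S) i).
Proof.
rewrite /same_part eq_pblock ?cover_char_parts //.
exact: trivIset_char_parts.
Qed.

Lemma char_part_def X i : X \in char_parts S -> i \in X ->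
  pblock (char_parts S) i = X.
Proof. exact: def_pblock trivIset_char_parts. Qed.

Lemma irr_lin i : 'chi[G]_i \is a linear_char.
Proof. exact/char_abelianP. Qed.

Lemma irr1_1 i : 'chi[G]_i 1 = 1%R.
Proof. exact/lin_char1/irr_lin. Qed.

Lemma cfdot_basic_char (X : {set Iirr G}) i :
  '[basic_char X, 'chi_i] = (i \in X)%:R%R.
Proof.
rewrite /basic_char cfdot_suml.
under eq_bigr do rewrite cfdotZl cfdot_irr irr1_1 mul1r.
have [Xi | X'i] := boolP (i \in X).
  by rewrite (bigD1 i) //= eqxx big1 ?addr0 // => j /andP[_ /negPf->].
by rewrite big1 // => j Xj; case: eqP => // ji; rewrite -ji Xj in X'i.
Qed.

Lemma basic_charE (X : {set Iirr G}) x : basic_char X x = (\sum_(i in X) 'chi_i x)%R.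
Proof.
by rewrite sum_cfunE; apply: eq_bigr => i _; rewrite cfunE irr1_1 mul1r.
Qed.

Lemma superclass_fun_span (f : 'CF(G)) : superclass_fun f ->
  f \in <<[seq cfun_indicator G B | B <- enum (superclasses S)]>>%VS.
Proof.
move=> Sf.
have ->: f = (\sum_(B in superclasses S) f (repr B) *: cfun_indicator G B)%R.
  apply/cfun_inP=> x Gx; rewrite sum_cfunE.
  rewrite (bigD1 (pblock (superclasses S) x)) ?superclass_mem //= big1.
    rewrite cfunE cfuniE -?sub_abelian_normal ?superclass_sub ?superclass_mem //.
    have xr: repr (pblock (superclasses S) x) \in pblock (superclasses S) x.
      exact/mem_repr/mem_superclass.
    rewrite mem_superclass // mulr1 addr0; apply: Sf; rewrite ?same_classE //.
    by rewrite (subsetP (superclass_sub (superclass_mem Gx))).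
  move=> B /andP[SB nB]; rewrite cfunE cfuniE -?sub_abelian_normal ?superclass_sub //.
  case: (boolP (x \in B)) => [/(superclass_def SB) Bx|]; last by rewrite mulr0.
  by rewrite Bx eqxx in nB.
rewrite memv_suml // => B SB; rewrite memvZ // memv_span //.
by apply: map_f; rewrite mem_enum.
Qed.

(** Let xi_X be the character attached to the part X by the definition of a
    supercharacter theory. The xi_X are orthogonal and as many as the superclasses, so they
    form a basis of the functions constant on superclasses. Hence the
    coefficients of such a function on a part X are proportional to those of
    xi_X; and those of xi_X are all equal, as the regular character, constant on
    superclasses because {1} is one, has all its coefficients equal to 1. *)
Lemma superclass_fun_coef (f : 'CF(G)) i j :
  superclass_fun f -> same_part i j -> '[f, 'chi_i] = '[f, 'chi_j].
Proof.
have /fin_all_exists[xi xiP] (X : {set Iirr G}) :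
    exists xi : 'CF(G), X \in char_parts S ->
    [/\ xi \is a character, xi != 0%R, {subset irr_constt xi <= X}
      & superclass_fun xi].
  have [SX|] := boolP (X \in char_parts S); last by exists 0%R.
  have [xi [? ? ? xiK]] := char_parts_constant SX.
  exists xi; split=> // x y Gx Gy; rewrite same_classE // => xy.
  by apply: (xiK (pblock (superclasses S) x)); rewrite ?superclass_mem ?mem_superclass.
have xi0 X k : X \in char_parts S -> k \notin X -> '[xi X, 'chi_k] = 0%R.
  move=> SX X'k; have [_ _ sub _] := xiP _ SX.
  by apply/eqP; apply: contraNT X'k => ?; apply: sub; rewrite irr_consttE.
have xiO X Y : X \in char_parts S -> Y \in char_parts S -> X != Y ->
    '[xi X, xi Y] = 0%R.
  move=> SX SY nXY; rewrite (cfun_sum_cfdot (xi X)) cfdot_suml big1 // => k _.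
  rewrite cfdotZl; have [Xk | X'k] := boolP (k \in X); last by rewrite xi0 ?mul0r.
  rewrite (cfdotC 'chi_k) (xi0 Y) ?rmorph0 ?mulr0 //.
  apply: contra nXY => Yk.
  by rewrite -(char_part_def SX Xk) -(char_part_def SY Yk).
pose s := [seq xi X | X <- enum (char_parts S)].
have free_s: free s.
  apply/orthogonal_free/pairwise_orthogonalP; split=> /=.
    apply/andP; split.
      apply/mapP=> [[X]]; rewrite mem_enum => SX /esym/eqP.
      by have [_ /negPf->] := xiP _ SX.
    rewrite map_inj_in_uniq ?enum_uniq // => X Y; rewrite !mem_enum => SX SY eXY.
    apply/eqP; apply/idPn=> /(xiO _ _ SX SY)/eqP.
    by rewrite -eXY cfnorm_eq0; have [_ /negPf->] := xiP _ SX.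
  move=> _ _ /mapP[X + ->] /mapP[Y + ->]; rewrite !mem_enum => SX SY nXY.
  by apply: xiO => //; apply: contra nXY => /eqP->.
pose W := <<[seq cfun_indicator G B | B <- enum (superclasses S)]>>%VS.
have sW: (<<s>> <= W)%VS.
  apply/span_subvP=> _ /mapP[X + ->]; rewrite mem_enum => SX.
  by apply: superclass_fun_span; have [] := xiP _ SX.
have eW: <<s>>%VS = W.
  apply/eqP; rewrite eqEdim sW (leq_trans (dim_span _)) //.
  move: free_s; rewrite /free => /eqP->.
  by rewrite !size_map -!cardE card_char_parts.
(* The identity is linear in h, so it is checked on the basis of the xi X. *)
have prop h k l : superclass_fun h -> same_part k l ->
    ('[h, 'chi_k] * '[xi (pblock (char_parts S) k), 'chi_l] =
     '[h, 'chi_l] * '[xi (pblock (char_parts S) k), 'chi_k])%R.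
  move=> Sh; rewrite same_partE => kl.
  have := superclass_fun_span Sh; rewrite -/W -eW => /(free_span free_s)[c -> _].
  rewrite !cfdot_suml !mulr_suml; apply: eq_big_seq => _ /mapP[X + ->].
  rewrite mem_enum => SX; rewrite !cfdotZl.
  have [Xk | X'k] := boolP (k \in X).
    by rewrite (char_part_def SX Xk) mulrAC.
  rewrite !(xi0 X) ?mulr0 ?mul0r //; apply: contra X'k => Xl.
  rewrite -(char_part_def SX Xl) (@char_part_def (pblock (char_parts S) k)) //.
    exact: mem_char_part.
  exact: char_part_mem.
have Sreg: superclass_fun (cfReg G).
  move=> x y Gx Gy xy; rewrite !cfRegE; congr (_ *+ _)%R; congr nat_of_bool.
  have G1 := group1 G; have S1 := superclass1 S.
  apply/eqP/eqP=> e; rewrite e same_classE // in xy.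
    by rewrite (superclass_def S1) ?set11 // in xy; apply/set1P.
  have {}xy: same_class x 1 by rewrite same_classE.
  rewrite /same_class eq_sym -/(same_class 1 x) same_classE // in xy.
  by rewrite (superclass_def S1) ?set11 // in xy; apply/set1P.
have reg1 k : '[cfReg G, 'chi_k] = 1%R.
  have ->: cfReg G = basic_char [set: Iirr G].
    by rewrite cfReg_sum; apply: eq_bigl => ?; rewrite inE.
  by rewrite cfdot_basic_char inE.
have xi_const k l : same_part k l ->
    '[xi (pblock (char_parts S) k), 'chi_l] = '[xi (pblock (char_parts S) k), 'chi_k].
  by move=> kl; have := prop _ _ _ Sreg kl; rewrite !reg1 !mul1r.
move=> Sf ij; have := prop _ _ _ Sf ij; rewrite xi_const //.
set b := '[xi _, _]; suff b0: b != 0%R by move/(mulIf b0).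
have SX := char_part_mem i; have [_ nz _ _] := xiP _ SX.
apply: contraNneq nz => b0; rewrite (cfun_sum_cfdot (xi _)) big1 // => k _.
have [ik|/xi0->] := boolP (k \in pblock (char_parts S) i); rewrite ?scale0r //.
by rewrite xi_const ?same_partE // -/b b0 scale0r.
Qed.

Lemma basic_char_superclass_fun X :
  X \in char_parts S -> superclass_fun (basic_char X).
Proof.
move=> SX; have [xi [_ nz sub xiK]] := char_parts_constant SX.
have Sxi: superclass_fun xi.
  move=> x y Gx Gy; rewrite same_classE // => xy.
  by apply: (xiK (pblock (superclasses S) x)); rewrite ?superclass_mem ?mem_superclass.
have [k Xk]: exists k, k \in X.
  have [X0|[k Xk]] := set_0Vmem X; last by exists k.
  by have /and3P[_ _ /negP[]] := char_parts_partition S; rewrite -X0.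
have xiE: xi = ('[xi, 'chi_k] *: basic_char X)%R.
  rewrite {1}(cfun_sum_cfdot xi) /basic_char (bigID (mem X)) /= addrC big1.
    rewrite add0r scaler_sumr; apply: eq_bigr => i Xi; rewrite irr1_1 scale1r.
    congr (_ *: _)%R; apply: superclass_fun_coef Sxi _.
    by rewrite same_partE (char_part_def SX Xi).
  move=> i X'i; suff /eqP->: '[xi, 'chi_i] == 0%R by rewrite scale0r.
  by apply: contraR X'i => ?; apply: sub; rewrite irr_consttE.
have b0: '[xi, 'chi_k] != 0%R.
  by apply: contraNneq nz => b0; rewrite xiE b0 scale0r.
move=> x y Gx Gy xy; apply: (mulfI b0).
by have := Sxi x y Gx Gy xy; rewrite xiE !cfunE cfdotZl cfdot_basic_char Xk mulr1.
Qed.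

(** The representative of X is arbitrary; X is never empty, so the default 0 does
    not occur. *)
Lemma sum_basic_char (f : 'CF(G)) :
    (forall i j, same_part i j -> '[f, 'chi_i] = '[f, 'chi_j]) ->
  f = (\sum_(X in char_parts S)
         '[f, 'chi_(odflt 0%R [pick i in X])] *: basic_char X)%R.
Proof.
move=> fP; rewrite {1}(cfun_sum_cfdot f).
rewrite (eq_bigl (mem (cover (char_parts S)))); last first.
  by move=> i; rewrite /= cover_char_parts inE.
rewrite (big_trivIset _ trivIset_char_parts) /=; apply: eq_bigr => X SX.
rewrite scaler_sumr; apply: eq_bigr => i Xi; rewrite irr1_1 scale1r.
congr (_ *: _)%R; apply: fP; rewrite same_partE (char_part_def SX) //.
by case: pickP => // X0; rewrite X0 in Xi.
Qed.

Lemma superclass_funP (f : 'CF(G)) :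
  superclass_fun f <-> (forall i j, same_part i j -> '[f, 'chi_i] = '[f, 'chi_j]).
Proof.
split=> [Sf i j|fP x y Gx Gy xy]; first exact: superclass_fun_coef.
rewrite (sum_basic_char fP) !sum_cfunE; apply: eq_bigr => X SX; rewrite !cfunE.
by congr (_ * _)%R; apply: basic_char_superclass_fun.
Qed.

Lemma superclass_fun_indicator B :
  B \in superclasses S -> superclass_fun (cfun_indicator G B).
Proof.
move=> SB u v Gu Gv; rewrite !cfuniE -?sub_abelian_normal ?superclass_sub //.
rewrite /same_class => uv; congr (_%:R)%R; congr nat_of_bool.
apply/idP/idP=> Bw; rewrite -(superclass_def SB Bw).
  by rewrite (eqP uv) mem_superclass.
by rewrite -(eqP uv) mem_superclass.
Qed.

(** Indicators of superclasses are combinations of basic characters. *)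
Lemma same_classP x y : x \in G -> y \in G ->
  (forall X, X \in char_parts S -> basic_char X x = basic_char X y) ->
  same_class x y.
Proof.
move=> Gx Gy xy; rewrite same_classE //; set B := pblock _ x.
have SB: B \in superclasses S by apply: superclass_mem.
have nB: B <| G by rewrite -sub_abelian_normal ?superclass_sub.
have fE := sum_basic_char ((superclass_funP _).1 (superclass_fun_indicator SB)).
have: cfun_indicator G B x = cfun_indicator G B y.
  by rewrite fE !sum_cfunE; apply: eq_bigr => X SX; rewrite !cfunE xy.
rewrite !cfuniE // mem_superclass //; case: (y \in B) => // /eqP.
by rewrite oner_eq0.
Qed.

End SuperclassFunctions.

(** * Symmetries of the superclasses and of the parts *)

Section Symmetries.

Variables (gT : finGroupType) (G : {group gT}) (S : superchar_theory G).
Hypothesis cGG : abelian G.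

(** On elements of G the Galois automorphism raising roots of unity to the power k
    turns the value at x of a basic character into its value at x ^+ k. *)
Lemma same_class_expg k x y : coprime k #|G| -> x \in G -> y \in G ->
  same_class S x y -> same_class S (x ^+ k) (y ^+ k).
Proof.
move=> /Qn_aut_exists[u uE] Gx Gy xy; apply: same_classP; rewrite ?groupX // => X SX.
have sE z : z \in G -> basic_char X (z ^+ k) = u (basic_char X z).
  move=> Gz; rewrite !basic_charE // rmorph_sum; apply: eq_bigr => i _.
  rewrite lin_charX ?irr_lin // uE // -lin_charX ?irr_lin //.
  by rewrite expg_cardG ?irr1_1.
by rewrite !sE //; congr (u _); apply: (basic_char_superclass_fun cGG SX Gx Gy xy).
Qed.

(** The coefficients of the indicator of {z} are the conjugates of the 'chi_i z up
    to a constant, so 'chi_i z is the same number c for all i in X, and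
    the value of the basic character of X at z * x is c times its value at x. *)
Lemma same_class_mulg z x y : [set z] \in superclasses S ->
    x \in G -> y \in G -> same_class S x y -> same_class S (z * x) (z * y).
Proof.
move=> Sz Gx Gy xy; have Gz: z \in G by rewrite -sub1set (superclass_sub Sz).
apply: same_classP; rewrite ?groupM // => X SX.
have zE i j : i \in X -> j \in X -> 'chi_i z = 'chi_j z.
  move=> Xi Xj; have ij: same_part S i j by rewrite same_partE (char_part_def SX Xi).
  have := superclass_fun_coef cGG (superclass_fun_indicator cGG Sz) ij.
  have dE k : '[cfun_indicator G [set z], 'chi_k] = (#|G|%:R^-1 * ('chi_k z)^*)%R.
    rewrite cfdotE (bigD1 z) //= big1 ?addr0.
      by rewrite cfuniE ?set11 ?mul1r -?sub_abelian_normal ?sub1set.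
    move=> t /andP[_ /negPf nt].
    by rewrite cfuniE ?inE ?nt ?mul0r -?sub_abelian_normal ?sub1set.
  rewrite !dE => /(mulfI _) e; apply: (can_inj conjCK); apply: e.
  by rewrite invr_eq0 neq0CG.
have [X0|[k Xk]] := set_0Vmem X; first by rewrite !basic_charE // X0 !big_set0.
have sE t : t \in G -> basic_char X (z * t) = ('chi_k z * basic_char X t)%R.
  move=> Gt; rewrite !basic_charE // mulr_sumr; apply: eq_bigr => i Xi.
  by rewrite lin_charM ?irr_lin // (zE i k).
by rewrite !sE //; congr (_ * _)%R; apply: (basic_char_superclass_fun cGG SX Gx Gy xy).
Qed.

(** A Galois conjugate of a basic character is still constant on superclasses, so
    its coefficients, which are the indicator of the conjugate of X, are constant
    on parts. *)
Lemma same_part_aut u i j :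
  same_part S (aut_Iirr u i) (aut_Iirr u j) -> same_part S i j.
Proof.
move=> ij; have SX := char_part_mem S i; set X := pblock _ i in SX.
have Sf: superclass_fun S (cfAut u (basic_char X)).
  move=> x y Gx Gy xy; rewrite !cfunE; congr (u _).
  exact: (basic_char_superclass_fun cGG SX Gx Gy xy).
have dE k : '[cfAut u (basic_char X), 'chi_(aut_Iirr u k)] = (k \in X)%:R%R.
  by rewrite aut_IirrE cfdot_aut_irr cfdot_basic_char // rmorph_nat.
have /eqP := superclass_fun_coef cGG Sf ij.
by rewrite !dE mem_char_part same_partE -/X; case: (j \in X); rewrite ?oner_eq0.
Qed.

(** The product of 'chi_l and a basic character is constant on superclasses; its
    coefficients are the indicator of the translate of X by 'chi_l. *)
Lemma same_part_mul l i i' j j' : [set l] \in char_parts S ->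
    'chi_i' = ('chi_l * 'chi_i)%R -> 'chi_j' = ('chi_l * 'chi_j)%R ->
  same_part S i' j' -> same_part S i j.
Proof.
move=> Sl iE jE ij; have SX := char_part_mem S i; set X := pblock _ i in SX.
have Sf: superclass_fun S ('chi_l * basic_char X)%R.
  move=> x y Gx Gy xy; rewrite !cfunE; congr (_ * _)%R.
    have := basic_char_superclass_fun cGG Sl Gx Gy xy.
    by rewrite !basic_charE // !big_set1.
  exact: (basic_char_superclass_fun cGG SX Gx Gy xy).
have dE k : '['chi_l * basic_char X, 'chi_l * 'chi_k]%R = (k \in X)%:R%R.
  rewrite -(cfdot_basic_char cGG) !cfdotE; congr (_ * _)%R; apply: eq_bigr => x Gx.
  rewrite !cfunE rmorphM mulrACA -normCK normC_lin_char ?irr_lin //.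
  by rewrite expr1n mul1r.
have /eqP := superclass_fun_coef cGG Sf ij.
rewrite iE jE !dE mem_char_part same_partE -/X.
by case: (j \in X); rewrite ?oner_eq0.
Qed.

Lemma Aut_memE (f : {perm gT}) x : f \in Aut G -> (f x \in G) = (x \in G).
Proof. by case/setIdP=> /perm_closed ->. Qed.

(** Composition with f permutes the characters of each part, so it leaves the
    basic characters unchanged. *)
Lemma Aut_same_class (f : {perm gT}) : f \in Aut G ->
    (forall i, exists2 j, same_part S i j & {in G, forall x, 'chi_j x = 'chi_i (f x)}) ->
  {in G, forall x, same_class S x (f x)}.
Proof.
move=> Af /fin_all_exists2[d dS dE] x Gx.
apply: same_classP; rewrite ?(Aut_memE _ Af) // => X SX.
have d_inj: injective d.
  move=> i j dij; apply: irr_inj; apply/cfun_inP=> y Gy.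
  have Gy': f^-1 y \in G by rewrite (Aut_memE _ (groupVr Af)).
  by have := dE i _ Gy'; rewrite dij dE // permKV.
rewrite !basic_charE // (reindex_inj d_inj) /=.
apply: eq_big => [i|i _]; last exact: dE.
have dXi := dS i; apply/idP/idP=> Xi; last first.
  by rewrite -(char_part_def SX Xi) -same_partE.
by rewrite -(char_part_def SX Xi) -same_partE /same_part eq_sym.
Qed.

(** The indicator of O is f-invariant, so its coefficients at 'chi_i and at
    'chi_j = 'chi_i o f agree: it is constant on superclasses. *)
Lemma stable_set_same_class (O : {set gT}) : O \subset G ->
    (forall i j, same_part S i j -> exists f : {perm gT}, [/\ f \in Aut G,
       {in O, forall x, f x \in O} & {in G, forall x, 'chi_j x = 'chi_i (f x)}]) ->
  forall x y, x \in O -> same_class S x y -> y \in O.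
Proof.
move=> sOG ijP x y Ox xy; have Gx := subsetP sOG x Ox.
have Gy := same_class_mem Gx xy.
have nO: O <| G by rewrite -sub_abelian_normal.
suff: superclass_fun S (cfun_indicator G O).
  move=> /(_ x y Gx Gy xy)/eqP; rewrite !cfuniE // Ox.
  by case: (y \in O); rewrite ?oner_eq0.
apply/(superclass_funP S cGG) => i j /ijP[f [Af fO fE]]; rewrite !cfdotE.
congr (_ * _)%R; rewrite (reindex_inj (@perm_inj _ f)) /=.
apply: eq_big => [z|z]; rewrite (Aut_memE _ Af) // => Gz.
rewrite fE //; congr (_ * _)%R; rewrite !cfuniE //; congr (_%:R)%R.
congr nat_of_bool.
have fOE: f @: O = O.
  apply/eqP; rewrite eqEcard card_imset ?leqnn ?andbT; last exact: perm_inj.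
  by apply/subsetP=> _ /imsetP[w Ow ->]; apply: fO.
by rewrite -{1}fOE mem_imset //; apply: perm_inj.
Qed.

(** The automorphisms preserving every superclass form a group; it only remains to
    know that it is transitive on each superclass. *)
Lemma from_automorphismsI :
    (forall x y, x \in G -> same_class S x y -> exists f : {perm gT},
       [/\ f \in Aut G, {in G, forall z, same_class S z (f z)} & f x = y]) ->
  from_automorphisms S.
Proof.
move=> xyP; pose A := [set f in Aut G | [forall z in G, same_class S z (f z)]].
have AP f : reflect (f \in Aut G /\ {in G, forall z, same_class S z (f z)}) (f \in A).
  by apply: (iffP setIdP) => -[? /forall_inP].
have gA: group_set A.
  apply/group_setP; split=> [|f g /AP[Af fS] /AP[Ag gS]]; apply/AP.
    by split=> [|z Gz]; rewrite ?group1 // perm1 /same_class.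
  split=> [|z Gz]; rewrite ?groupM // permM /same_class (eqP (fS z Gz)).
  by apply: gS; rewrite (Aut_memE _ Af).
exists (group gA); split=> [|/=]; first by apply/subsetP=> f /AP[].
have orbE x : x \in G -> orbit 'P A x = pblock (superclasses S) x.
  move=> Gx; apply/setP=> y; apply/orbitP/idP=> [[f /AP[Af fS] <-]|].
    by rewrite -same_classE // /aperm; apply: fS.
  rewrite -same_classE // => /(xyP x y Gx)[f [Af fS fx]].
  by exists f => //; apply/AP.
apply/setP=> B; apply/idP/imsetP=> [SB|[x Gx ->]].
  have [x Bx Gx] := superclass_nonempty SB; exists x => //.
  by rewrite orbE // (superclass_def SB).
by rewrite orbE // superclass_mem.
Qed.

End Symmetries.

(** * Supercharacter theories of groups of prime order *)

Lemma basic_char_character (gT : finGroupType) (G : {group gT}) (X : {set Iirr G}) :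
  basic_char X \is a character.
Proof.
rewrite /basic_char rpred_sum // => i _; rewrite irr1_degree scaler_nat.
by rewrite rpredMn ?irr_char.
Qed.

Lemma generator_prime (gT : finGroupType) (P : {group gT}) x :
  prime #|P| -> x \in P -> x != 1 -> <[x]> = P.
Proof.
move=> prP Px nx1; apply/eqP; rewrite eqEsubset cycle_subG Px /=.
apply: contraR nx1 => /(prime_TIg prP) ti.
by rewrite -cycle_eq1 -(setIidPr (_ : <[x]> \subset P)) ?ti // cycle_subG.
Qed.

(** With x a generator of P and w a primitive root of unity, the map sending the
    character x |-> w ^+ k to x ^+ k is a bijection g from Irr(P) to P that commutes
    with power maps. The parts are the preimages under g of the blocks. If y ~ z
    are not 1, then y is a generator and z = y ^+ n with n prime to p, so the n-th
    power map stabilizes every block, hence every part: this makes the basic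
    characters equal at y and z. *)
Lemma prime_superchar_theory (gT : finGroupType) (P : {group gT})
    (Q : {set {set gT}}) :
    prime #|P| -> partition Q P -> [set 1] \in Q ->
    (forall k x y, coprime k #|P| -> x \in P -> y \in P ->
       pblock Q x = pblock Q y -> pblock Q (x ^+ k) = pblock Q (y ^+ k)) ->
  exists U : superchar_theory P, superclasses U = Q.
Proof.
move=> prP partQ Q1 Qexp; have /and3P[/eqP coverQ tiQ _] := partQ.
have /cyclicP[x defP] := prime_cyclic prP.
have Px: x \in P by rewrite defP cycle_id.
have cPP: abelian P by rewrite defP cycle_abelian.
have ox: #[x] = #|P| by rewrite defP.
have [w prim_w] := C_prim_root_exists (prime_gt0 prP).
have chi_pow (i : Iirr P) : ('chi_i x ^+ #|P| = 1)%R.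
  by rewrite -ox lin_char_unity_root ?irr_lin.
pose k i := sval (prim_rootP prim_w (chi_pow i)).
have kE i : ('chi_i x = w ^+ k i)%R by rewrite /k; case: prim_rootP.
pose g i := x ^+ k i.
have gP i : g i \in P by rewrite groupX.
have chi_inj i j : 'chi[P]_i x = 'chi_j x -> i = j.
  move=> ij; apply: irr_inj; apply/cfun_inP=> y; rewrite {1}defP.
  by case/cycleP=> n ->; rewrite !lin_charX ?irr_lin ?ij.
have gE i j n : (g i == g j ^+ n) = ('chi_i x == 'chi_j x ^+ n)%R.
  rewrite !kE /g -expgM -GRing.exprM eq_expg_mod_order ox.
  by rewrite (eq_prim_root_expr prim_w).
have g_inj: injective g.
  by move=> i j /eqP; rewrite -[g j]expg1 gE GRing.expr1 => /eqP/chi_inj.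
have imG: g @: [set: Iirr P] = P.
  apply/eqP; rewrite eqEcard card_imset // cardsT card_Iirr_abelian // leqnn.
  by rewrite andbT; apply/subsetP=> _ /imsetP[i _ ->].
pose pre (B : {set gT}) := g @^-1: B.
have imK B : B \in Q -> g @: pre B = B.
  move=> QB; apply/setP=> y; apply/imsetP/idP=> [[i + ->]|By]; first by rewrite inE.
  have: y \in P by rewrite -coverQ; apply/bigcupP; exists B.
  move=> Py; have: y \in g @: setT by rewrite imG.
  by case/imsetP=> i _ yi; exists i; rewrite // inE -yi.
have QE: [set g @: (B : {set Iirr P}) | B in pre @: Q] = Q.
  apply/setP=> B; apply/imsetP/idP=> [[_ /imsetP[C QC ->] ->]|QB].
    by rewrite imK.
  by exists (pre B); rewrite ?imset_f ?imK.
have partX: partition (pre @: Q) [set: Iirr P].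
  by move: partQ; rewrite -(imset_partition _ _ g_inj) QE imG.
have cardX: #|pre @: Q| = #|Q|.
  rewrite card_in_imset // => B C QB QC eBC.
  by rewrite -(imK B QB) -(imK C QC) eBC.
have constX (X : {set Iirr P}) : X \in pre @: Q -> exists xi : 'CF(P),
    [/\ xi \is a character, xi != 0%R, {subset irr_constt xi <= X}
      & forall B : {set gT}, B \in Q -> {in B &, forall x y, xi x = xi y}].
  move=> QX; exists (basic_char X); have [B QB defX] := imsetP QX.
  split=> [|||C QC y z Cy Cz]; first exact: basic_char_character.
  - have [X0|[i Xi]] := set_0Vmem X.
      by have /and3P[_ _ /negP[]] := partX; rewrite -X0.
    apply/eqP=> sX0; have := cfdot_basic_char cPP X i.
    by rewrite sX0 cfdot0l Xi => /eqP; rewrite eq_sym oner_eq0.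
  - by move=> i; rewrite irr_consttE cfdot_basic_char // pnatr_eq0 eqb0 negbK.
  have CP t : t \in C -> t \in P by rewrite -coverQ => Ct; apply/bigcupP; exists C.
  have [y1|nty] := eqVneq y 1.
    have C1: C = [set 1] by rewrite -(def_pblock tiQ Q1 (set11 1)) (def_pblock tiQ QC) -?y1.
    by move: Cy Cz; rewrite C1 => /set1P-> /set1P->.
  have defPy := generator_prime prP (CP y Cy) nty.
  have: z \in <[y]> by rewrite defPy CP.
  case/cycleP=> n zn.
  have con: coprime n #|P|.
    rewrite coprime_sym prime_coprime //; apply: contra nty => /dvdnP[m nm].
    have z1: z = 1 by rewrite zn nm mulnC expgM expg_cardG ?expg1n ?CP.
    have C1: C = [set 1] by rewrite -(def_pblock tiQ Q1 (set11 1)) (def_pblock tiQ QC) -?z1.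
    by rewrite -in_set1 -C1.
  have yz: pblock Q y = pblock Q (y ^+ n) by rewrite -zn !(def_pblock tiQ QC).
  have [u uE] := Qn_aut_exists con.
  have auE (i : Iirr P) t : t \in P -> 'chi_(aut_Iirr u i) t = 'chi_i (t ^+ n).
    move=> Pt; rewrite aut_IirrE cfunE uE; first by rewrite lin_charX ?irr_lin.
    by rewrite -lin_charX ?irr_lin // expg_cardG ?irr1_1.
  have gau i : g (aut_Iirr u i) = g i ^+ n.
    by apply/eqP; rewrite gE auE // lin_charX ?irr_lin.
  (* Galois conjugation by u realizes the n-th power map on Irr(P). *)
  rewrite zn !basic_charE // (reindex_inj (@aut_Iirr_inj _ _ u)) /=.
  apply: eq_big => [i|i _]; last by rewrite auE ?CP.
  rewrite defX !inE gau.
  have: g i \in <[y]> by rewrite defPy.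
  case/cycleP=> m gi.
  have: pblock Q (g i) = pblock Q (g i ^+ n).
    have [com|] := boolP (coprime m #|P|).
      by rewrite gi -expgM mulnC expgM; apply: Qexp; rewrite // ?groupX ?CP.
    rewrite coprime_sym prime_coprime // negbK => /dvdnP[l ml].
    by rewrite gi ml mulnC expgM expg_cardG ?expg1n ?CP.
  move=> gin; apply/idP/idP=> Bg; rewrite -(def_pblock tiQ QB Bg).
    by rewrite -gin mem_pblock coverQ.
  by rewrite gin mem_pblock coverQ groupX.
by exists (SupercharTheory partX partQ cardX Q1 constX).
Qed.

(** * Recognizing products *)

Section Products.

Variables (p : nat) (gT : finGroupType) (G : {group gT}) (S : superchar_theory G).
Hypotheses (p_pr : prime p) (cGG : abelian G) (oG : #|G| = (p ^ 2)%N).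

Lemma restricted_theory (H : {group gT}) : H \subset G -> #|H| = p ->
    (forall x y, x \in H -> same_class S x y -> y \in H) ->
  exists U : superchar_theory H,
    superclasses U = [set C in superclasses S | C \subset H].
Proof.
move=> sHG oH HS; set Q := [set C in _ | _].
have sub_H x : x \in H -> pblock (superclasses S) x \subset H.
  move=> Hx; apply/subsetP=> y; rewrite -same_classE ?(subsetP sHG) //.
  exact: HS.
have sQ: Q \subset superclasses S by apply/subsetP=> C /setIdP[].
have tiQ: trivIset Q by apply: trivIsetS sQ (trivIset_superclasses S).
have QP x : x \in H -> pblock (superclasses S) x \in Q.
  by move=> Hx; rewrite inE superclass_mem ?(subsetP sHG) ?sub_H.
have QE x : x \in H -> pblock Q x = pblock (superclasses S) x.
  move=> Hx; apply: def_pblock => //; first exact: QP.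
  by rewrite mem_superclass ?(subsetP sHG).
apply: prime_superchar_theory; rewrite ?oH //.
- apply/and3P; split=> //.
    rewrite eqEsubset; apply/andP; split.
      by apply/bigcupsP=> C /setIdP[].
    apply/subsetP=> x Hx; apply/bigcupP; exists (pblock (superclasses S) x).
      exact: QP.
    by rewrite mem_superclass ?(subsetP sHG).
  apply: contra (subsetP sQ _) _.
  by have /and3P[] := superclasses_partition S.
- by rewrite inE superclass1 sub1set group1.
move=> k x y cok Hx Hy; rewrite !QE ?groupX // => xy; apply/eqP.
by apply: same_class_expg; rewrite ?(subsetP sHG) ?oG ?coprimeXr // /same_class xy.
Qed.

(** Both factors come from power-invariant partitions of groups of order p: the
    superclasses inside N, and the images in G / N of all superclasses. *)
Lemma star_productI (N : {group gT}) : N \subset G -> #|N| = p ->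
    (forall x y, x \in N -> same_class S x y -> y \in N) ->
    (forall x n, x \in G -> x \notin N -> n \in N -> same_class S x (n * x)) ->
  exists (U : superchar_theory N) (V : superchar_theory (G / N)%G),
    is_star_product S U V.
Proof.
move=> sNG oN NS GS.
have nNG: G \subset 'N(N) by apply: sub_abelian_norm.
have oGN: #|G / N| = p.
  by rewrite card_quotient // -divgS // oG oN expnS expn1 mulnK ?prime_gt0.
have [U defU] := restricted_theory sNG oN NS.
pose cl x := pblock (superclasses S) x.
have clG x : x \in G -> cl x \subset G.
  by move=> Gx; apply: superclass_sub (superclass_mem S Gx).
have clN x : x \in N -> cl x \subset N.
  move=> Nx; apply/subsetP=> y; rewrite -same_classE ?(subsetP sNG) //.
  exact: NS.
have mem_clq x y : x \in G -> y \in cl x -> coset N y \in cl x / N.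
  move=> Gx xy; apply: mem_morphim => //; apply: (subsetP nNG).
  exact: subsetP (clG x Gx) y xy.
have clNE x : x \in N -> cl x / N = 1.
  move=> Nx; apply/eqP; rewrite eqEsubset sub_quotient_pre; last first.
    by rewrite (subset_trans _ nNG) ?clG ?(subsetP sNG).
  rewrite cosetpre1 clN // sub1set /=; have <- := coset_id Nx.
  by rewrite mem_clq ?mem_superclass ?(subsetP sNG).
have sym x y : same_class S x y -> same_class S y x.
  by rewrite /same_class eq_sym.
(* Outside N a superclass is a union of cosets of N, so its image determines it. *)
have clE x y : x \in G -> x \notin N -> y \in G ->
    (coset N y \in cl x / N) = same_class S x y.
  move=> Gx N'x Gy; apply/idP/idP=> [/morphimP[z nNz clz yz]|xy]; last first.
    by apply: mem_clq; rewrite -?same_classE.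
  rewrite /= -same_classE // in clz.
  have Gz := same_class_mem Gx clz.
  have N'z: z \notin N by apply: contra N'x => Nz; apply: NS Nz (sym _ _ clz).
  have: y \in N :* z.
    by rewrite -val_coset // -yz val_coset ?rcoset_refl ?(subsetP nNG).
  by case/rcosetP=> n Nn ->; rewrite /same_class (eqP clz); apply: GS.
have clNN x y : x \in N -> y \in G -> (coset N y \in cl x / N) = (y \in N).
  by move=> Nx Gy; rewrite clNE // inE (sameP eqP (kerP _ _)) ?(subsetP nNG) // ker_coset.
pose Q := [set C / N | C : {set gT} in superclasses S].
have QP x : x \in G -> cl x / N \in Q by move=> Gx; rewrite imset_f ?superclass_mem.
have QI B : B \in Q -> exists2 x, x \in G & B = cl x / N.
  case/imsetP=> C SC ->; have [x Cx Gx] := superclass_nonempty SC.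
  by exists x; rewrite /cl ?(superclass_def SC).
have mem_cl x : x \in G -> coset N x \in cl x / N.
  by move=> Gx; rewrite mem_clq ?mem_superclass.
have QE x y : x \in G -> y \in G -> coset N y \in cl x / N -> cl x / N = cl y / N.
  move=> Gx Gy; have [Nx|N'x] := boolP (x \in N).
    by rewrite clNN // => Ny; rewrite !clNE.
  by rewrite clE // /cl => /eqP->.
have tiQ: trivIset Q.
  apply/trivIsetP=> _ _ /QI[x Gx ->] /QI[y Gy ->]; apply: contraR.
  case/pred0Pn=> xb /andP[/= xbx xby].
  have: xb \in G / N by apply: subsetP xbx; rewrite quotientS ?clG.
  case/morphimP=> z nNz Gz /= xbz; rewrite xbz in xbx xby.
  by rewrite (QE x z) // (QE y z).
have pQ x : x \in G -> pblock Q (coset N x) = cl x / N.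
  by move=> Gx; apply: def_pblock; rewrite ?QP ?mem_cl.
have [||||V defV] := @prime_superchar_theory _ (G / N)%G Q.
- by rewrite oGN.
- apply/and3P; split=> //.
    rewrite eqEsubset; apply/andP; split.
      by apply/bigcupsP=> _ /QI[x Gx ->]; rewrite quotientS ?clG.
    apply/subsetP=> _ /morphimP[x nNx Gx ->]; apply/bigcupP.
    by exists (cl x / N); rewrite ?QP ?mem_cl.
  apply/negP=> /QI[x Gx]; move/setP/(_ (coset N x)).
  by rewrite mem_cl // inE.
- by have := QP 1 (group1 G); rewrite clNE ?group1.
- move=> k _ _ cok /morphimP[x nNx Gx ->] /morphimP[y nNy Gy ->] /=.
  rewrite -!morphX // !pQ ?groupX // => xy.
  have: coset N y \in cl x / N by rewrite xy mem_cl.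
  have [Nx|N'x] := boolP (x \in N).
    by rewrite clNN // => Ny; rewrite !clNE ?groupX.
  rewrite clE // => {}xy; apply: QE; rewrite ?groupX // mem_clq ?groupX //.
  rewrite -same_classE ?groupX //; apply: same_class_expg => //.
  by move: cok; rewrite oGN oG; apply: coprimeXr.
exists U, V; rewrite /is_star_product defU defV.
have preE x : x \in G -> x \notin N -> G :&: coset N @*^-1 (cl x / N) = cl x.
  move=> Gx N'x; apply/setP=> y; rewrite inE.
  have [Gy|G'y] /= := boolP (y \in G); last first.
    by apply/esym; apply: contraNF G'y; apply: subsetP (clG x Gx) y.
  rewrite morphpreE in_setI (subsetP nNG) // andTb inE -same_classE //; exact: clE.
apply/setP=> C; apply/idP/setUP=> [SC|[/setIdP[]//|]].
  have [x Cx Gx] := superclass_nonempty SC.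
  have [Nx|N'x] := boolP (x \in N); [left | right].
    by rewrite inE SC -(superclass_def SC Cx) clN.
  apply/imsetP; exists (cl x / N); last by rewrite preE // /cl (superclass_def SC).
  rewrite !inE QP // andbT; apply: contra N'x => /eqP x1.
  by have := mem_cl x Gx; rewrite x1 => /set1P/coset_idr; apply; rewrite ?(subsetP nNG).
case/imsetP=> B /setD1P[ntB /QI[x Gx defB] ->].
have N'x: x \notin N by apply: contra ntB => Nx; rewrite defB clNE.
by rewrite defB preE // superclass_mem.
Qed.

(** The hypothesis makes H a union of superclasses and every element of K a
    superclass by itself, so that restriction of S supplies both factors. *)
Lemma direct_productI (H K : {group gT}) : H \x K = G -> #|H| = p -> #|K| = p ->
    (forall h h' k k', h \in H -> h' \in H -> k \in K -> k' \in K ->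
       same_class S (h * k) (h' * k') = (k == k') && same_class S h h') ->
  exists (E : superchar_theory H) (F : superchar_theory K),
    is_direct_product S E F.
Proof.
move=> defG oH oK HKS.
have [_ defHK _ _] := dprodP defG.
have sHG: H \subset G by rewrite -defHK mulG_subl.
have sKG: K \subset G by rewrite -defHK mulG_subr.
have HG := subsetP sHG; have KG := subsetP sKG.
have decomp y : y \in G -> exists h k, [/\ h \in H, k \in K & y = h * k].
  by rewrite -{1}defHK => /mulsgP[h k ? ? ->]; exists h, k.
have S1 y : same_class S 1 y -> y = 1.
  rewrite same_classE // (superclass_def (superclass1 S)) ?set11 //.
  by move/set1P.
have HS h y : h \in H -> same_class S h y -> y \in H.
  move=> Hh hy; have [h' [k' [Hh' Kk' e]]] := decomp y (same_class_mem (HG h Hh) hy).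
  move: hy; rewrite e -{1}[h]mulg1 HKS // => /andP[/eqP<- _].
  by rewrite mulg1.
have KS k y : k \in K -> same_class S k y -> y = k.
  move=> Kk ky; have [h' [k' [Hh' Kk' e]]] := decomp y (same_class_mem (KG k Kk) ky).
  move: ky; rewrite e -{1}[k]mul1g HKS // => /andP[/eqP<- /S1->].
  by rewrite mul1g.
have [E defE] := restricted_theory sHG oH HS.
have [F defF]: exists F : superchar_theory K,
    superclasses F = [set C in superclasses S | C \subset K].
  by apply: restricted_theory => // k y Kk /(KS k y Kk)->.
exists E, F; rewrite /is_direct_product defE defF.
have clE h k : h \in H -> k \in K -> pblock (superclasses S) (h * k) =
    pblock (superclasses S) h * pblock (superclasses S) k.
  move=> Hh Kk; have [Gh Gk] := (HG h Hh, KG k Kk).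
  apply/setP=> y; rewrite -same_classE ?groupM //.
  apply/idP/mulsgP=> [hky|[h' k' + + ->]].
    have [h' [k' [Hh' Kk' e]]] := decomp y (same_class_mem (groupM Gh Gk) hky).
    move: hky; rewrite e HKS // => /andP[/eqP<- hh'].
    by exists h' k; rewrite -?same_classE // /same_class.
  rewrite -!same_classE // => hh' /(KS _ _ Kk)->.
  by rewrite HKS ?eqxx // (HS h).
apply/setP=> C; apply/idP/imset2P=> [SC|[A B /setIdP[SA sAH] /setIdP[SB sBK] ->]].
  have [x Cx Gx] := superclass_nonempty SC; have [h [k [Hh Kk e]]] := decomp x Gx.
  exists (pblock (superclasses S) h) (pblock (superclasses S) k).
  - rewrite inE superclass_mem ?HG //; apply/subsetP=> y.
    by rewrite -same_classE ?HG //; apply: HS.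
  - rewrite inE superclass_mem ?KG //; apply/subsetP=> y.
    by rewrite -same_classE ?KG // => /(KS k y Kk)->.
  by rewrite -clE // -e (superclass_def SC).
have [h Ah _] := superclass_nonempty SA; have [k Bk _] := superclass_nonempty SB.
have Hh := subsetP sAH h Ah; have Kk := subsetP sBK k Bk.
rewrite -(superclass_def SA Ah) -(superclass_def SB Bk) -clE //.
by rewrite superclass_mem // groupM ?(HG h) ?(KG k).
Qed.
End Products.

(** * Colourings of the plane invariant under scalars and vertical translations *)

(** A partition is encoded by the map c sending a point to its block. *)
Section AffineColouring.

Local Open Scope ring_scope.

Variables (F : finFieldType) (T : eqType) (c : F * F -> T) (t0 : F).
Hypothesis t0_neq0 : t0 != 0.
Hypothesis c_scale : forall k i j i' j', k != 0 ->
  c (i, j) = c (i', j') -> c (k * i, k * j) = c (k * i', k * j').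
Hypothesis c_shift0 : forall i j i' j',
  c (i, j) = c (i', j') -> c (i, j + t0) = c (i', j' + t0).
Hypothesis c_fix : forall i j, c (i, j) = c (0, 1) -> i = 0 /\ j = 1.

(** One translation is enough: conjugating it by scalars gives all the others. *)
Lemma c_shift t i j i' j' :
  c (i, j) = c (i', j') -> c (i, j + t) = c (i', j' + t).
Proof.
have [-> | t_neq0] := eqVneq t 0; first by rewrite !addr0.
have k_neq0: t / t0 != 0 by rewrite mulf_neq0 ?invr_eq0.
have ki_neq0: t0 / t != 0 by rewrite mulf_neq0 ?invr_eq0.
move=> /(c_scale ki_neq0)/c_shift0/(c_scale k_neq0).
have e x : t / t0 * (t0 / t * x) = x by field; rewrite t0_neq0 t_neq0.
have e' x : t / t0 * (t0 / t * x + t0) = x + t by field; rewrite t0_neq0 t_neq0.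
by rewrite !e !e'.
Qed.

Lemma c_fix_axis i j t : c (i, j) = c (0, t) -> i = 0 /\ j = t.
Proof.
move/(c_shift (1 - t)); rewrite [t + _]addrC subrK => /c_fix[-> e]; split=> //.
by apply: (addIr (1 - t)); rewrite e addrC subrK.
Qed.

(** The pair (a, r) stands for the map (i, j) |-> (a i, j + r i), which sends
    (1, 0) to (a, r). As these maps permute the points off the axis regularly, the
    block of (1, 0) is also its own stabilizer. *)
Definition stab a r := c (a, r) == c (1, 0).

Lemma stab10 : stab 1 0.
Proof. exact: eqxx. Qed.

Lemma stab_neq0 a r : stab a r -> a != 0.
Proof.
move=> /eqP h; apply/eqP=> a0; move: h; rewrite a0 => /esym/c_fix_axis[/eqP].
by rewrite oner_eq0.
Qed.

Lemma stabM a r b q : stab a r -> stab b q -> stab (a * b) (r * b + q).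
Proof.
move=> /eqP ar bq; have b0 := stab_neq0 bq; move: bq => /eqP bq.
have := c_shift q (c_scale b0 ar); rewrite mulr0 mulr1 add0r bq => e.
by rewrite /stab [a * b]mulrC [r * b]mulrC e.
Qed.

(** Off the axis, scaling by i^-1 and translating moves (i, j) to (1, 0); on the axis
    the maps are the identity and the blocks are points. *)
Lemma colourP i j i' j' :
  c (i', j') = c (i, j) <-> exists a r, [/\ stab a r, i' = a * i & j' = j + r * i].
Proof.
have [-> | i0] := eqVneq i 0.
  split=> [/c_fix_axis[-> ->]|[a [r [_ -> ->]]]].
    by exists 1, 0; rewrite stab10 !mulr0 addr0.
  by rewrite !mulr0 addr0.
split=> [e|[a [r [/eqP ar -> ->]]]].
  exists (i' / i), ((j' - j) / i); rewrite !divfK // [_ + (j' - j)]addrC subrK; split=> //.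
  have i'0: i^-1 != 0 by rewrite invr_eq0.
  have := c_scale i'0 (c_shift (- j) e); rewrite subrr mulr0 mulVf // => e'.
  by rewrite /stab [i' / i]mulrC [_ / i]mulrC e'.
have := c_shift j (c_scale i0 ar); rewrite mulr0 mulr1 add0r => <-.
by rewrite [a * i]mulrC [r * i]mulrC [j + _]addrC.
Qed.

(** If some (1, r) with r != 0 stabilizes, so do all (1, t), as F is generated by r
    additively. Otherwise a determines r, and the stabilizer is commutative
    because (a, r) and (b, q) have products with the same first component; comparing
    the two products for one fixed b != 1 gives r = q / (b - 1) * (a - 1). If there
    is no such b, then a = 1 and r = 0. *)
Lemma stab_dichotomy : (forall x : F, exists n, x = n%:R) ->
  (forall a r t, stab a r -> stab a (r + t)) \/
  (exists k, forall a r, stab a r -> r = k * (a - 1)).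
Proof.
move=> F_prime.
have [/existsP[r /andP[r0 s1r]] | no_r] := boolP [exists r, (r != 0) && stab 1 r].
  left=> a q t aq.
  suff s1t: stab 1 (t / a).
    by have := stabM s1t aq; rewrite mul1r divfK ?(stab_neq0 aq) // addrC.
  have [n tn] := F_prime (t / a / r).
  have ->: t / a = r *+ n by rewrite -mulr_natl -tn divfK.
  elim: n {tn} => [|n IHn]; first by rewrite mulr0n stab10.
  by have := stabM IHn s1r; rewrite !mulr1 addrC -mulrS.
right; have s1 r : stab 1 r -> r = 0.
  by move=> s1r; apply: contraNeq no_r => r0; apply/existsP; exists r; rewrite r0.
have inj a r q : stab a r -> stab a q -> r = q.
  move=> /eqP ar /eqP aq; have a0: a != 0 by apply: (@stab_neq0 a r); apply/eqP.
  have ai: a^-1 != 0 by rewrite invr_eq0.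
  have e: c (a, r) = c (a, q) by rewrite ar aq.
  have := c_scale ai (c_shift (- q) e); rewrite subrr mulr0 mulVf // => /eqP/s1/eqP.
  by rewrite mulf_eq0 (negPf ai) /= subr_eq0 => /eqP.
have com a r b q : stab a r -> stab b q -> r * b + q = q * a + r.
  move=> ar bq; apply: inj (stabM ar bq) _.
  by rewrite [a * b]mulrC; apply: stabM.
have [/existsP[b /existsP[q /andP[b1 bq]]] | no_b] :=
  boolP [exists b, exists q, (b != 1) && stab b q].
  exists (q / (b - 1)) => a r ar; have e := com _ _ _ _ ar bq.
  have b1': b - 1 != 0 by rewrite subr_eq0.
  apply: (mulIf b1'); rewrite mulrAC divfK //.
  by have ->: r * (b - 1) = r * b + q - q - r by [ring]; rewrite e; ring.
exists 0 => a r ar; rewrite mul0r; apply: s1.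
suff a1: a = 1 by rewrite -a1.
by apply: contraNeq no_b => a1; apply/existsP; exists a; apply/existsP; exists r; rewrite a1.
Qed.
End AffineColouring.

(** * Coordinates on an elementary abelian group of order p ^ 2 and on its dual *)

Section PrimeFieldExponents.

Variable p : nat.
Hypothesis p_pr : prime p.

Lemma Fp_addE (s t : 'F_p) : (s + t : 'F_p)%R = ((s + t) %% p)%N :> nat.
Proof. by congr modn; apply: Fp_cast. Qed.

Lemma Fp_mulE (s t : 'F_p) : (s * t : 'F_p)%R = ((s * t) %% p)%N :> nat.
Proof. by congr modn; apply: Fp_cast. Qed.

Lemma Fp_nat_surj (s : 'F_p) : exists n, s = n%:R%R.
Proof. by exists s; rewrite natr_Zp. Qed.

Lemma Fp_coprime (s : 'F_p) : s != 0%R -> coprime s p.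
Proof.
move=> s0; rewrite coprime_sym prime_coprime // gtnNdvd ?lt0n //.
by rewrite (leq_trans (ltn_ord s)) // Fp_cast.
Qed.

Variables (gT : finGroupType) (z : gT).
Hypothesis zp1 : z ^+ p = 1.

Lemma expgFpD (s t : 'F_p) : z ^+ (s + t : 'F_p)%R = z ^+ s * z ^+ t.
Proof. by rewrite Fp_addE expg_mod // expgD. Qed.

Lemma expgFpM (s t : 'F_p) : z ^+ (s * t : 'F_p)%R = z ^+ s ^+ t.
Proof. by rewrite Fp_mulE expg_mod // expgM. Qed.

Lemma expgFp_nat n : z ^+ (n%:R%R : 'F_p) = z ^+ n.
Proof. by rewrite val_Fp_nat // expg_mod. Qed.

End PrimeFieldExponents.

Section RootPowers.

Variables (p : nat) (w : algC).
Hypotheses (p_pr : prime p) (w1 : (w ^+ p = 1)%R).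

Lemma exprFpD (s t : 'F_p) : (w ^+ (s + t : 'F_p)%R = w ^+ s * w ^+ t)%R.
Proof. by rewrite Fp_addE // expr_mod // exprD. Qed.

Lemma exprFpM (s t : 'F_p) : (w ^+ (s * t : 'F_p)%R = w ^+ s ^+ t)%R.
Proof. by rewrite Fp_mulE // expr_mod // GRing.exprM. Qed.

Lemma exprFp_nat n : (w ^+ (n%:R : 'F_p) = w ^+ n)%R.
Proof. by rewrite val_Fp_nat // expr_mod. Qed.

End RootPowers.

Section Coordinates.

Variables (p : nat) (gT : finGroupType) (G : {group gT}) (x y : gT).
Hypotheses (p_pr : prime p) (cGG : abelian G) (oG : #|G| = (p ^ 2)%N).
Hypothesis (G_exp : {in G, forall g, g ^+ p = 1}).
Hypotheses (Gx : x \in G) (Gy : y \in G) (y_neq1 : y != 1) (y'x : x \notin <[y]>).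

Local Notation F := 'F_p.

Definition point (u : F * F) := x ^+ u.1 * y ^+ u.2.

Lemma pointE s t : point (s, t) = x ^+ s * y ^+ t.
Proof. by []. Qed.

Lemma point_in u : point u \in G.
Proof. by rewrite groupM ?groupX. Qed.

Lemma pointD : {morph point : u v / (u + v)%R >-> u * v}.
Proof.
move=> u v; rewrite /point !expgFpD ?G_exp // !mulgA; congr (_ * _).
by rewrite -!mulgA; congr (_ * _); apply: (centsP cGG); rewrite groupX.
Qed.

Lemma point0 : point 0%R = 1.
Proof. by rewrite /point !expg0 mulg1. Qed.

Lemma pointZ (k : F) s t : point (k * s, k * t)%R = point (s, t) ^+ k.
Proof.
rewrite !pointE expgMn; last by apply: (centsP cGG); rewrite groupX.
by rewrite (GRing.mulrC k s) (GRing.mulrC k t) !expgFpM ?G_exp.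
Qed.

Lemma point_x s : point (s, 0%R) = x ^+ s.
Proof. by rewrite /point expg0 mulg1. Qed.

Lemma point_y t : point (0%R, t) = y ^+ t.
Proof. by rewrite /point expg0 mul1g. Qed.

Lemma point1 : point (1, 0)%R = x.
Proof. by rewrite point_x -[(1 : 'F_p)%R]/(1%:R)%R expgFp_nat ?G_exp. Qed.

Lemma point2 : point (0, 1)%R = y.
Proof. by rewrite point_y -[(1 : 'F_p)%R]/(1%:R)%R expgFp_nat ?G_exp. Qed.

Lemma order_basis g : g \in G -> g != 1 -> #[g] = p.
Proof.
move=> Gg ntg; have := order_dvdn g p; rewrite G_exp // eqxx.
by move/(prime_nt_dvdP p_pr (contraNneq _ ntg)) => <- //; move/eqP; rewrite order_eq1.
Qed.

Lemma point_inj : injective point.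
Proof.
suff ker u : point u = 1 -> u = 0%R.
  move=> u v uv; apply/eqP; rewrite -GRing.subr_eq0; apply/eqP/ker.
  by apply: (mulIg (point v)); rewrite -pointD GRing.subrK mul1g.
case: u => s t st1; have [s0|s0] := eqVneq s 0%R.
  move: st1; rewrite s0 point_y => /eqP; rewrite -order_dvdn order_basis // => pt.
  have [->//|t0] := eqVneq t 0%R.
  by have := Fp_coprime p_pr t0; rewrite coprime_sym prime_coprime // pt.
case/negP: y'x; have := pointZ (s^-1)%R s t.
rewrite st1 expg1n GRing.mulVf // pointE => /eqP.
rewrite -[(1 : 'F_p)%R]/(1%:R)%R expgFp_nat ?G_exp // -eq_invg_mul => /eqP e.
by rewrite -groupV e mem_cycle.
Qed.

Lemma point_onto g : g \in G -> exists s t, g = point (s, t).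
Proof.
have: point @: [set: F * F] = G.
  apply/eqP; rewrite eqEcard card_imset; last exact: point_inj.
  rewrite cardsT card_prod card_Fp // oG expnS expn1 leqnn andbT.
  by apply/subsetP=> _ /imsetP[u _ ->]; apply: point_in.
by move=> <- /imsetP[[s t] _ ->]; exists s, t.
Qed.

Lemma point_aut (M : F * F -> F * F) : {morph M : u v / (u + v)%R} -> injective M ->
  exists2 f : {perm gT}, f \in Aut G & forall u, f (point u) = point (M u).
Proof.
move=> MD M_inj; pose co g := odflt 0%R [pick u | point u == g].
have coK : cancel point co.
  by move=> u; rewrite /co; case: pickP => [v /eqP/point_inj|/(_ u)/eqP].
have Kco g : g \in G -> point (co g) = g.
  by case/point_onto=> s [t ->]; rewrite coK.
pose h g := point (M (co g)).
have hM : {in G &, {morph h : g g' / g * g'}}.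
  move=> g g' Gg Gg'; rewrite /h -pointD -MD; congr (point (M _)).
  by apply: point_inj; rewrite pointD !Kco ?groupM.
pose hm := Morphism hM.
have inj_h: 'injm hm.
  apply/injmP=> g g' Gg Gg' /point_inj/M_inj e.
  by rewrite -(Kco g) // e Kco.
have hG: hm @* G = G.
  apply/eqP; rewrite eqEcard card_injm // leqnn andbT.
  by apply/subsetP=> _ /morphimP[g _ Gg ->]; apply: point_in.
exists (aut inj_h hG); first exact: Aut_aut.
by move=> u; rewrite autE ?point_in //= /h coK.
Qed.

Variable w : algC.
Hypothesis prim_w : p.-primitive_root w.

(** The characters of G are determined by their values at x and y, which are
    powers of w; there are p ^ 2 of them, so every pair of powers occurs. *)
Lemma dual_coordinates : exists xi : F * F -> Iirr G, bijective xi /\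
  forall i j s t, ('chi_(xi (i, j)) (point (s, t)) = w ^+ (i * s + j * t : 'F_p)%R)%R.
Proof.
have w1 := prim_expr_order prim_w.
have chi_pow (i : Iirr G) g : g \in G -> ('chi_i g ^+ p = 1)%R.
  by move=> Gg; rewrite -lin_charX ?irr_lin // G_exp ?irr1_1.
pose k (i : Iirr G) : F * F :=
  ((sval (prim_rootP prim_w (chi_pow i x Gx)) : nat)%:R%R,
   (sval (prim_rootP prim_w (chi_pow i y Gy)) : nat)%:R%R).
have kE i s t : 'chi_i (point (s, t)) = (w ^+ ((k i).1 * s + (k i).2 * t : 'F_p)%R)%R.
  rewrite exprFpD // !exprFpM // !exprFp_nat //.
  case: prim_rootP => a /= <-; case: prim_rootP => b /= <-.
  by rewrite lin_charM ?irr_lin ?groupX // !lin_charX ?irr_lin.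
have k_inj: injective k.
  move=> i j ij; apply: irr_inj; apply/cfun_inP=> g /point_onto[s [t ->]].
  by rewrite !kE ij.
have [|xi kK xiK] := inj_card_bij k_inj.
  by rewrite card_Iirr_abelian // oG card_prod card_Fp.
exists xi; split=> [|i j s t]; first by exists k.
by rewrite kE xiK.
Qed.

End Coordinates.

(** * A nonidentity superclass of size one *)

Definition comes_from_product (gT : finGroupType) (G : {group gT})
    (S : superchar_theory G) : Prop :=
  (exists (N : {group gT}) (U : superchar_theory N) (V : superchar_theory (G / N)%G),
      [/\ N :!=: 1, N \proper G & is_star_product S U V])
  \/
  (exists (H K : {group gT}) (E : superchar_theory H) (F : superchar_theory K),
      [/\ H :!=: 1, H \proper G, K :!=: 1, K \proper G
        & H \x K = G /\ is_direct_product S E F]).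

Section SingletonSuperclass.

Variables (p : nat) (gT : finGroupType) (G : {group gT}) (S : superchar_theory G).
Hypotheses (p_pr : prime p) (cGG : abelian G) (oG : #|G| = (p ^ 2)%N).
Hypothesis (G_exp : {in G, forall g, g ^+ p = 1}).

Local Notation F := 'F_p.

Lemma pairD (s t s' t' : F) : ((s, t) + (s', t') = (s + s', t + t'))%R.
Proof. by []. Qed.

Lemma proper_order_p (N : {group gT}) : N \subset G -> #|N| = p ->
  N :!=: 1 /\ N \proper G.
Proof.
move=> sNG oN; rewrite -cardG_gt1 oN prime_gt1 // properEcard sNG oN oG.
by rewrite expnS expn1 -{1}[p]mul1n ltn_pmul2r ?prime_gt0 ?prime_gt1.
Qed.

Lemma cycle_order_p x : x \in G -> x != 1 -> <[x]> \subset G /\ #|<[x]>| = p.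
Proof.
by move=> Gx ntx; rewrite cycle_subG Gx; split=> //; exact: (order_basis p_pr G_exp Gx ntx).
Qed.

Lemma comes_from_star_product (x : gT) : x \in G -> x != 1 ->
    (forall g h, g \in <[x]> -> same_class S g h -> h \in <[x]>) ->
    (forall g n, g \in G -> g \notin <[x]> -> same_class S g (x ^+ n * g)) ->
  comes_from_product S.
Proof.
move=> Gx ntx NS GS; left; have [sNG oN] := cycle_order_p Gx ntx.
have [|U [V UV]] := star_productI p_pr cGG oG sNG oN NS.
  by move=> g n Gg N'g /cycleP[m ->]; apply: GS.
by have [nt1 pr] := proper_order_p sNG oN; exists <[x]>%G, U, V.
Qed.

Lemma comes_from_direct_product (x y : gT) : x \in G -> y \in G -> y != 1 -> x \notin <[y]> ->
    (forall s s' t t' : F,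
       same_class S (x ^+ s * y ^+ t) (x ^+ s' * y ^+ t') =
       (t == t') && same_class S (x ^+ s) (x ^+ s')) ->
  comes_from_product S.
Proof.
move=> Gx Gy nty y'x xyS; right.
have ntx: x != 1 by apply: contraNneq y'x => ->; apply: group1.
have [sHG oH] := cycle_order_p Gx ntx; have [sKG oK] := cycle_order_p Gy nty.
have [ntH prH] := proper_order_p sHG oH; have [ntK prK] := proper_order_p sKG oK.
have tiHK: <[x]> :&: <[y]> = 1.
  by apply: prime_TIg; rewrite ?oH // cycle_subG.
have defG: <[x]> \x <[y]> = G.
  rewrite dprodE //; last first.
    exact: subset_trans sKG (subset_trans cGG (centS sHG)).
  by apply/eqP; rewrite eqEcard mul_subG // TI_cardMg // oH oK oG expnS expn1 leqnn.
have cycF z g : z \in G -> g \in <[z]> -> exists s : F, g = z ^+ s.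
  by move=> Gz /cycleP[n ->]; exists (n%:R)%R; rewrite expgFp_nat ?G_exp.
have [|E [F' EF]] := direct_productI (S := S) p_pr cGG oG defG oH oK.
  move=> h h' k k' /(cycF _ _ Gx)[s ->] /(cycF _ _ Gx)[s' ->].
  move=> /(cycF _ _ Gy)[t ->] /(cycF _ _ Gy)[t' ->]; rewrite xyS; congr (_ && _).
  apply/eqP/eqP=> [->//|e].
  have := @point_inj p gT G x y p_pr cGG G_exp Gx Gy nty y'x (0%R, t) (0%R, t').
  by rewrite !pointE e => /(_ erefl)[].
by exists <[x]>%G, <[y]>%G, E, F'.
Qed.

(** With z as second basis vector, the automorphisms (i, j) |-> (a i, j + r i)
    preserve superclasses and are transitive on them. In the conjugate case
    r = k (a - 1) they fix z and raise x z^k to the power a. *)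
Lemma singleton_class_case z : [set z] \in superclasses S -> z != 1 ->
  comes_from_product S /\ from_automorphisms S.
Proof.
move=> Sz ntz; have Gz: z \in G by rewrite -sub1set (superclass_sub Sz).
have [sZG oZ] := cycle_order_p Gz ntz.
have [_ /properP[_ [x Gx z'x]]] := proper_order_p sZG oZ.
pose pt := point (p := p) x z.
have ptG u : pt u \in G by apply: point_in.
have pt_inj: injective pt := point_inj p_pr cGG G_exp Gx Gz ntz z'x.
have pt_onto := point_onto p_pr cGG oG G_exp Gx Gz ntz z'x.
have ptD : {morph pt : u v / (u + v)%R >-> u * v} := pointD p_pr cGG G_exp Gx Gz.
have pt_y t : pt (0, t)%R = z ^+ t := point_y x z t.
have pt2 : pt (0, 1)%R = z := point2 x p_pr G_exp Gz.
pose c u := pblock (superclasses S) (pt u).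
have shiftE i j t : pt (i, j + t)%R = z ^+ t * pt (i, j).
  by rewrite -pt_y -ptD pairD GRing.add0r GRing.addrC.
have c_scale k i j i' j' : (k != 0)%R -> c (i, j) = c (i', j') ->
    c (k * i, k * j)%R = c (k * i', k * j')%R.
  move=> k0 e; apply/eqP; rewrite /c /pt !(pointZ p_pr cGG G_exp Gx Gz).
  apply: same_class_expg; rewrite ?ptG ?oG ?coprimeXr ?Fp_coprime //.
  exact/eqP.
have c_shift0 i j i' j' : c (i, j) = c (i', j') -> c (i, j + 1)%R = c (i', j' + 1)%R.
  move=> e; apply/eqP; rewrite /c !shiftE -pt_y pt2.
  by apply: same_class_mulg; rewrite ?ptG //; apply/eqP.
have c_fix i j : c (i, j) = c (0, 1)%R -> i = 0%R /\ j = 1%R.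
  rewrite /c pt2 (superclass_def Sz (set11 z)) => e.
  have := mem_superclass S (ptG (i, j)); rewrite e => /set1P.
  by rewrite -pt2 => /pt_inj[].
have one0 : (1 != 0 :> F)%R by apply: oner_neq0.
have colour := colourP one0 c_scale c_shift0 c_fix.
split; last first.
  apply: from_automorphismsI => // g h Gg gh.
  have [i [j gE]] := pt_onto g Gg.
  have [i' [j' hE]] := pt_onto h (same_class_mem Gg gh).
  have [a [r [ar i'E j'E]]] : exists a r,
      [/\ stab c a r, i' = (a * i)%R & j' = (j + r * i)%R].
    by apply/colour/eqP; rewrite eq_sym -/pt in gE hE *; move: gh; rewrite gE hE.
  have a0 := stab_neq0 one0 c_scale c_shift0 c_fix ar.
  pose M (u : F * F) := (a * u.1, u.2 + r * u.1)%R.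
  have MD : {morph M : u v / (u + v)%R}.
    by move=> [u1 u2] [v1 v2]; rewrite /M !pairD /=; congr (_, _); ring.
  have M_inj : injective M.
    move=> [u1 u2] [v1 v2] e.
    have e1 : (a * u1 = a * v1)%R := congr1 fst e.
    have e2 : (u2 + r * u1 = v2 + r * v1)%R := congr1 snd e.
    by move: e2; rewrite (mulfI a0 e1) => /GRing.addIr->.
  have [f Af fE] := point_aut p_pr cGG oG G_exp Gx Gz ntz z'x MD M_inj.
  exists f; split=> //; last by rewrite gE hE fE /M /= -i'E -j'E.
  move=> _ /pt_onto[s [t ->]]; rewrite fE /same_class eq_sym; apply/eqP.
  by apply/colour; exists a, r.
have Z_pt t : pt (0, t)%R \in <[z]> by rewrite pt_y mem_cycle.
have [sh|[k ks]] := stab_dichotomy one0 c_scale c_shift0 c_fix (@Fp_nat_surj p).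
  apply: (comes_from_star_product Gz ntz) => [g h Zg gh|g n Gg Z'g].
    have Gg : g \in G := subsetP sZG g Zg.
    have [i' [j' hE]] := pt_onto h (same_class_mem Gg gh).
    case/cycleP: Zg => n gE.
    have {}gE: g = pt (0%R, n%:R%R) by rewrite pt_y expgFp_nat ?G_exp.
    have [a [r [_ i'E j'E]]] : exists a r,
        [/\ stab c a r, i' = (a * 0)%R & j' = (n%:R + r * 0)%R].
      by apply/colour/eqP; rewrite eq_sym; move: gh; rewrite gE hE.
    by rewrite hE i'E GRing.mulr0 Z_pt.
  have [i [j gE]] := pt_onto g Gg.
  have i0: (i != 0)%R by apply: contraNneq Z'g => i0; rewrite gE i0 Z_pt.
  rewrite -(expgFp_nat p_pr) ?G_exp // gE -shiftE /same_class eq_sym; apply/eqP.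
  apply/colour; exists 1%R, (n%:R / i)%R; rewrite GRing.mul1r GRing.divfK //.
  by split=> //; rewrite -[X in stab c _ X]GRing.add0r; apply/sh/stab10.
(* The first factor is the line through (1, k), which the maps with
   r = k (a - 1) stabilize. *)
have [h1 h1E] : exists h1, h1 = pt (1, k)%R by eexists.
have hE s t : h1 ^+ (s : F) * z ^+ (t : F) = pt (s, k * s + t)%R.
  rewrite h1E -(pointZ p_pr cGG G_exp Gx Gz) -pt_y -ptD pairD.
  by rewrite GRing.mulr1 GRing.addr0 (GRing.mulrC s).
apply: (@comes_from_direct_product h1 z) => //; first by rewrite h1E.
  rewrite h1E -[k]GRing.add0r shiftE groupMl ?mem_cycle //.
  by rewrite /pt (point1 z p_pr G_exp Gx).
move=> s s' t t'.
have hE0 (s0 : F) : h1 ^+ s0 = pt (s0, k * s0)%R.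
  by rewrite -[(k * s0)%R]GRing.addr0 -hE expg0 mulg1.
rewrite !hE !hE0 /same_class -!/(c _) ![c (s, _) == _]eq_sym.
have shift := c_shift one0 c_scale c_shift0.
apply/eqP/andP=> [e|[/eqP<- /eqP/(shift t)]] //.
have [a [r [ar s'E e2]]] := (colour _ _ _ _).1 e.
have tt: t = t'.
  apply: (GRing.addrI (k * s')%R); rewrite e2 s'E (ks _ _ ar); ring.
split; first exact/eqP.
have := shift (- t)%R _ _ _ _ e; rewrite -tt !GRing.addrK.
by move->.
Qed.
End SingletonSuperclass.

(** * A nonprincipal linear supercharacter *)

Lemma prime_primitive_root (p : nat) (w : algC) :
  prime p -> (w ^+ p = 1)%R -> w != 1%R -> (p.-primitive_root w)%R.
Proof.
move=> p_pr wp1 nw1; have [m prim_w dv] := prim_order_exists (prime_gt0 p_pr) wp1.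
have m1 : m != 1%N.
  by apply: contraNneq nw1 => m1; move: (prim_expr_order prim_w); rewrite m1 GRing.expr1 => ->.
by move/(prime_nt_dvdP p_pr m1): dv => <-.
Qed.

Section SingletonPart.

Variables (p : nat) (gT : finGroupType) (G : {group gT}) (S : superchar_theory G).
Hypotheses (p_pr : prime p) (cGG : abelian G) (oG : #|G| = (p ^ 2)%N).
Hypothesis (G_exp : {in G, forall g, g ^+ p = 1}).

Local Notation F := 'F_p.

(** Any x outside <y> can be corrected by a power of y to lie in the kernel of
    'chi_l, since 'chi_l y already generates the p-th roots of unity. *)
Lemma linear_char_basis l : 'chi[G]_l != 1%R -> exists x y,
  [/\ x \in G, y \in G, y != 1, x \notin <[y]> &
      'chi_l x = 1%R /\ (p.-primitive_root ('chi_l y))%R].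
Proof.
move=> ntl; have [y Gy ly1]: exists2 y, y \in G & 'chi_l y != 1%R.
  apply/exists_inP; apply: contraR ntl => /exists_inPn l1.
  by apply/eqP/cfun_inP=> y Gy; rewrite cfun1E Gy; apply/eqP/negbNE/l1.
have lp g : g \in G -> ('chi_l g ^+ p = 1)%R.
  by move=> Gg; rewrite -lin_charX ?irr_lin // G_exp ?irr1_1.
have prim := prime_primitive_root p_pr (lp y Gy) ly1.
have nty: y != 1 by apply: contraNneq ly1 => ->; rewrite irr1_1.
have [sYG oY] := cycle_order_p p_pr G_exp Gy nty.
have [_ /properP[_ [x Gx y'x]]] := proper_order_p p_pr oG sYG oY.
have [k lx] := prim_rootP prim (lp x Gx).
exists (x * y ^- k), y; split=> //.
- by rewrite groupM ?groupV ?groupX.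
- by rewrite groupMr // groupV mem_cycle.
split=> //; rewrite lin_charM ?irr_lin ?groupV ?groupX // lin_charV ?irr_lin ?groupX //.
rewrite lin_charX ?irr_lin // -lx divrr // unitfE.
by rewrite -[('chi_l x)%R]/('chi_l x) lin_char_neq0 ?irr_lin.
Qed.

(** The colouring describes the parts of Irr(G); M a r below is the
    adjoint of (i, j) |-> (a i, j + r i) for the pairing i s + j t. *)
Lemma singleton_part_case l : [set l] \in char_parts S -> 'chi_l != 1%R ->
  comes_from_product S /\ from_automorphisms S.
Proof.
move=> Sl ntl; have [x [y [Gx Gy nty y'x [lx prim_w]]]] := linear_char_basis ntl.
set w := 'chi_l y in prim_w.
have wp1 := prim_expr_order prim_w.
have ntx: x != 1 by apply: contraNneq y'x => ->; apply: group1.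
have [sXG oX] := cycle_order_p p_pr G_exp Gx ntx.
have [xi [[xi' xiK xi'K] xiE]] :=
  dual_coordinates p_pr cGG oG G_exp Gx Gy nty y'x prim_w.
have xi_onto i : exists a b, i = xi (a, b).
  by case E: (xi' i) => [a b]; exists a, b; rewrite -E xi'K.
pose pt := point (p := p) x y.
have ptG u : pt u \in G by apply: point_in.
have pt_inj: injective pt := point_inj p_pr cGG G_exp Gx Gy nty y'x.
have pt_onto := point_onto p_pr cGG oG G_exp Gx Gy nty y'x.
have ptD : {morph pt : u v / (u + v)%R >-> u * v} := pointD p_pr cGG G_exp Gx Gy.
have pt_x s : pt (s, 0)%R = x ^+ s := point_x x y s.
have chi_eq i j : (forall s t, 'chi_i (pt (s, t)) = 'chi[G]_j (pt (s, t))) -> i = j.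
  by move=> e; apply: irr_inj; apply/cfun_inP=> g /pt_onto[s [t ->]]; apply: e.
have lE : l = xi (0, 1)%R.
  apply: chi_eq => s t; rewrite xiE GRing.mul0r GRing.add0r GRing.mul1r /pt pointE.
  by rewrite lin_charM ?irr_lin ?groupX // !lin_charX ?irr_lin // lx GRing.expr1n GRing.mul1r.
pose c v := pblock (char_parts S) (xi v).
have c_scale (k i j i' j' : F) : (k != 0)%R -> c (i, j) = c (i', j') ->
    c (k * i, k * j)%R = c (k * i', k * j')%R.
  move=> k0 e; have ki0 : (k^-1 != 0)%R by rewrite GRing.invr_eq0.
  (* same_part_aut goes from conjugates to originals, whence the inverse of k. *)
  have [u uE] := Qn_aut_exists (Fp_coprime p_pr ki0).
  have auE i1 j1 : aut_Iirr u (xi (k * i1, k * j1)%R) = xi (i1, j1).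
    apply: chi_eq => s t; rewrite aut_IirrE cfunE !xiE uE; last first.
      by rewrite -GRing.exprM mulnC GRing.exprM wp1 GRing.expr1n.
    rewrite -(exprFpM p_pr wp1); congr (_ ^+ (_ : F))%R.
    by field.
  by apply/eqP/(same_part_aut cGG (u := u)); rewrite !auE; apply/eqP.
have c_shift0 (i j i' j' : F) : c (i, j) = c (i', j') ->
    c (i, j + (- 1))%R = c (i', j' + (- 1))%R.
  have mulE i1 j1 : 'chi_(xi (i1, j1)) = ('chi_l * 'chi_(xi (i1, j1 + (- 1))))%R.
    apply/cfun_inP=> _ /pt_onto[s [t ->]]; rewrite cfunE lE !xiE.
    rewrite -(exprFpD p_pr wp1); congr (_ ^+ (_ : F))%R; ring.
  move=> e; apply/eqP; apply: (same_part_mul cGG Sl (mulE _ _) (mulE _ _)).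
  exact/eqP.
have c_fix i j : c (i, j) = c (0, 1)%R -> i = 0%R /\ j = 1%R.
  rewrite /c -lE (char_part_def Sl (set11 l)) => e.
  have := mem_char_part S (xi (i, j)); rewrite e => /set1P.
  by rewrite lE => /(can_inj xiK)[].
have t00 : (- 1 != 0 :> F)%R by rewrite oppr_eq0 oner_neq0.
have colour := colourP t00 c_scale c_shift0 c_fix.
have stab_neq0 := stab_neq0 t00 c_scale c_shift0 c_fix.
pose M a r (u : F * F) := (a * u.1 + r * u.2, u.2)%R.
have autM a r : stab c a r -> exists2 f : {perm gT}, f \in Aut G &
    forall u, f (pt u) = pt (M a r u).
  move=> ar; apply: (point_aut p_pr cGG oG G_exp Gx Gy nty y'x).
    by move=> [u1 u2] [v1 v2]; rewrite /M !pairD /=; congr (_, _); ring.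
  move=> [u1 u2] [v1 v2] e.
  have e2 : (u2 = v2)%R := congr1 snd e.
  have e1 : (a * u1 + r * u2 = a * v1 + r * v2)%R := congr1 fst e.
  by move: e1; rewrite e2 => /GRing.addIr/(mulfI (stab_neq0 _ _ ar))->.
have dualM a r i j (f : {perm gT}) : (forall u, f (pt u) = pt (M a r u)) ->
    {in G, forall g, 'chi_(xi (a * i, j + r * i)%R) g = 'chi_(xi (i, j)) (f g)}.
  move=> fE _ /pt_onto[s [t ->]]; rewrite fE /M !xiE; congr (_ ^+ (_ : F))%R.
  rewrite /=; ring.
have autS a r (f : {perm gT}) : stab c a r -> f \in Aut G ->
    (forall u, f (pt u) = pt (M a r u)) -> {in G, forall g, same_class S g (f g)}.
  move=> ar Af fE; apply: Aut_same_class => // i.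
  have [i1 [j1 ->]] := xi_onto i; exists (xi (a * i1, j1 + r * i1)%R).
    by rewrite /same_part eq_sym; apply/eqP/colour; exists a, r.
  exact: dualM.
(* The orbit O of (s, t) under the maps M a r is a union of superclasses. *)
have classP s t g : same_class S (pt (s, t)) g ->
    exists a r, stab c a r /\ g = pt (M a r (s, t)).
  pose O := [set pt (M q.1 q.2 (s, t)) | q in [set q | stab c q.1 q.2]].
  move=> stg; suff: g \in O.
    by case/imsetP=> [[a r]]; rewrite inE /= => ar ->; exists a, r.
  apply: (stable_set_same_class cGG _ _ _ stg).
  - by apply/subsetP=> _ /imsetP[q _ ->].
  - move=> i j; have [i1 [j1 ->]] := xi_onto i; have [i2 [j2 ->]] := xi_onto j.
    rewrite /same_part eq_sym => /eqP/colour[a [r [ar -> ->]]].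
    have [f Af fE] := autM a r ar; exists f; split=> //; last exact: dualM.
    move=> _ /imsetP[[b q] + ->]; rewrite inE fE /= => bq.
    apply/imsetP; exists (b * a, q * a + r)%R.
      by rewrite inE /=; apply: stabM t00 c_scale c_shift0 c_fix _ _ _ _ bq ar.
    by congr (pt _); rewrite /M; congr (_, _) => /=; ring.
  apply/imsetP; exists (1, 0)%R; first by rewrite inE; apply: stab10.
  by congr (pt _); rewrite /M; congr (_, _) => /=; ring.
split; last first.
  apply: from_automorphismsI => // g h Gg gh.
  have [s [t gE]] := pt_onto g Gg.
  have [a [r [ar hE]]] : exists a r, stab c a r /\ h = pt (M a r (s, t)).
    by apply: classP; move: gh; rewrite gE.
  have [f Af fE] := autM a r ar.
  by exists f; split=> //; [apply: autS fE | rewrite gE hE fE].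
have X_pt s : pt (s, 0)%R \in <[x]> by rewrite pt_x mem_cycle.
have [sh|[k ks]] := stab_dichotomy t00 c_scale c_shift0 c_fix (@Fp_nat_surj p).
  apply: (comes_from_star_product p_pr cGG oG G_exp Gx ntx) => [g h Xg gh|g n Gg X'g].
    case/cycleP: Xg => n gE.
    have {}gE: g = pt (n%:R%R, 0%R) by rewrite pt_x expgFp_nat ?G_exp.
    have [a [r [_ ->]]] : exists a r, stab c a r /\ h = pt (M a r (n%:R%R, 0%R)).
      by apply: classP; rewrite -gE.
    exact: X_pt.
  have [s [t gE]] := pt_onto g Gg.
  have t0: (t != 0)%R by apply: contraNneq X'g => t0; rewrite gE t0 X_pt.
  have st: stab c 1%R (n%:R / t)%R.
    by rewrite -[X in stab c _ X]GRing.add0r; apply/sh/stab10.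
  have [f Af fE] := autM _ _ st.
  suff <-: f g = x ^+ n * g by apply: autS fE _ Gg.
  rewrite gE fE /M -(expgFp_nat p_pr) ?G_exp // -pt_x -ptD pairD.
  by congr (pt (_, _)); rewrite /= ?GRing.add0r // GRing.mul1r GRing.divfK // GRing.addrC.
(* The maps M a r with r = k (a - 1) fix (- k, 1) and stabilize the axis of x. *)
have [z zE] : exists z, z = pt (- k, 1)%R by eexists.
have hE s t : x ^+ (s : F) * z ^+ (t : F) = pt (s - k * t, t)%R.
  rewrite zE -(pointZ p_pr cGG G_exp Gx Gy) -pt_x -ptD pairD.
  by congr (pt (_, _)); ring.
have Gz : z \in G by rewrite zE.
have pt0 : pt (0, 0)%R = 1 := point0 _ x y.
have hz (t : F) : z ^+ t = pt (- (k * t), t)%R.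
  by rewrite -[_ ^+ t]mul1g -(expg0 x) -[0%N]/((0 : F)%R : nat) hE GRing.sub0r.
apply: (@comes_from_direct_product p gT G S p_pr cGG oG G_exp x z) => //.
- rewrite zE -pt0; apply: contra_neq (oner_neq0 F) => /pt_inj e.
  exact: (congr1 snd e).
- apply/cycleP=> -[n]; rewrite -(expgFp_nat p_pr) ?G_exp // hz.
  rewrite -(point1 y p_pr G_exp Gx) => /pt_inj e.
  have e1 : (1 = - (k * n%:R))%R := congr1 fst e.
  have e2 : (0 = n%:R :> F)%R := congr1 snd e.
  by move/eqP: e1; rewrite -e2 GRing.mulr0 GRing.oppr0 oner_eq0.
move=> s s' t t'; rewrite !hE -!pt_x.
apply/idP/andP=> [/classP[a [r [ar /pt_inj e]]]|[/eqP<- /classP[a [r [ar /pt_inj e]]]]].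
  have e1 : (s' - k * t' = a * (s - k * t) + r * t)%R := congr1 fst e.
  have e2 : (t' = t)%R := congr1 snd e.
  have [f Af fE] := autM _ _ ar; split; first by rewrite e2.
  suff ->: pt (s', 0)%R = f (pt (s, 0)%R) by apply: autS fE _ _.
  rewrite fE /M; congr (pt (_, _)); apply: (GRing.addIr (- (k * t')))%R.
  by rewrite e1 e2 (ks _ _ ar) /=; ring.
have e1 : (s' = a * s + r * 0)%R := congr1 fst e.
have [f Af fE] := autM _ _ ar.
suff ->: pt (s' - k * t, t)%R = f (pt (s - k * t, t)%R) by apply: autS fE _ _.
by rewrite fE /M; congr (pt (_, _)); rewrite e1 (ks _ _ ar) /=; ring.
Qed.
End SingletonPart.

Theorem theorem2 (p : nat) (p_prime : prime p) (gT : finGroupType)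
    (G : {group gT}) (G_CpCp : G \isog [set: 'Z_p * 'Z_p])
    (S : superchar_theory G)
    (S_hyp :
      (exists C : {set gT},
        [/\ C \in superclasses S, C != [set 1] & #|C| = 1%N])
      \/
      (exists X : {set Iirr G},
        [/\ X \in char_parts S, basic_char X \is a linear_char
          & basic_char X != 1%R])) :
  ((exists (N : {group gT}) (U : superchar_theory N)
           (V : superchar_theory (G / N)%G),
      [/\ N :!=: 1, N \proper G & is_star_product S U V])
   \/
   (exists (H K : {group gT}) (E : superchar_theory H)
           (F : superchar_theory K),
      [/\ H :!=: 1, H \proper G, K :!=: 1, K \proper G
        & H \x K = G /\ is_direct_product S E F]))
  /\ from_automorphisms S.
Proof.
have oZ : #|'Z_p| = p by rewrite card_ord Zp_cast ?prime_gt1.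
have oG : #|G| = (p ^ 2)%N by rewrite (card_isog G_CpCp) cardsT card_prod oZ.
have cGG : abelian G.
  rewrite (isog_abelian G_CpCp); apply/centsP=> u _ v _.
  by congr (_, _); apply: GRing.addrC.
have G_exp : {in G, forall g, g ^+ p = 1}.
  have [f injf _] := isogP G_CpCp; move=> g Gg; apply: (injmP injf).
  - exact: groupX.
  - exact: group1.
  have pairX (u : 'Z_p * 'Z_p) n : u ^+ n = (u.1 ^+ n, u.2 ^+ n).
    by elim: n => [//|n IHn]; rewrite !expgS IHn.
  have Zp1 (a : 'Z_p) : a ^+ p = 1.
    apply/eqP; rewrite -order_dvdn -[X in (_ %| X)%N]oZ -cardsT.
    by rewrite (order_dvdG (G := setT_group 'Z_p)) ?inE.
  by rewrite morphX // morph1 pairX !Zp1.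
case: S_hyp => [[C [SC ntC /eqP/cards1P[z Cz]]]|[X [SX linX ntX]]].
  apply: (singleton_class_case p_prime cGG oG G_exp (z := z)); rewrite -?Cz //.
  by apply: contraNneq ntC => z1; rewrite Cz z1.
have oX : #|X| = 1%N.
  have := lin_char1 linX; rewrite basic_charE // => e.
  apply/eqP; rewrite -(pnatr_eq1 algC) -sumr_const; rewrite -[X in _ == X]e.
  by apply/eqP/eq_bigr=> i _; rewrite irr1_1.
have /cards1P[l Xl] : #|X| == 1%N by rewrite oX.
apply: (singleton_part_case p_prime cGG oG G_exp (l := l)); rewrite -?Xl //.
by apply: contraNneq ntX => l1; rewrite /basic_char Xl big_set1 l1 cfun1E group1 scale1r.
Qed.
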